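(* Let $n\ge 1$ be an integer and let $R$ be a finite commutative ring with $1$ having $q$ elements. Let $N_{(1)},\dots,N_{(n)}:R\to\{0,1,\dots,q-1\}$ be bijections of types $c_1,\dots,c_n\in R$ respectively, and let $N'_{(1)},\dots,N'_{(2n)}:R\to\{0,1,\dots,q-1\}$ be bijections of types $c'_1,\dots,c'_{2n}\in R$ respectively. Define the bijections $N_n:R^n\to\{1,\dots,q^n\}$ and $N'_{2n}:R^{2n}\to\{1,\dots,q^{2n}\}$ by $$N_n(a_1,\dots,a_n)=1+\sum_{j=1}^n q^{j-1}N_{(j)}(a_j),\qquad N'_{2n}(a_1,\dots,a_{2n})=1+\sum_{j=1}^{2n} q^{j-1}N'_{(j)}(a_j).$$ Suppose that $X\in GL_{2n}(R)$ is an $n$-multimagic generator matrix. Then for any $t\in R^{2n}$ the $q^n\times q^n$ matrix $M$ defined by $$M_{N_n(a),N_n(b)}=N'_{2n}\left(X\begin{pmatrix}a\\ b\end{pmatrix}+t\right),\qquad a,b\in R^n,$$ is a normal $n$-multimagic square.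
   Context: For $c\in R$, a bijection $N:R\to\{0,1,\dots,q-1\}$ is called of type $c$ if $N(a)+N(-a+c)=q-1$ for all $a\in R$. A matrix $X\in GL_{2n}(R)$ (an invertible $2n\times 2n$ matrix over $R$) is called an $n$-multimagic generator matrix if, writing $X=(A\ B)$ with $A,B$ matrices of size $2n\times n$ over $R$ (the first $n$ and last $n$ columns of $X$), all $n\times n$ minors of $A$, $B$, $A+B$ and $A-B$ are units in $R$. An $m\times m$ matrix of natural numbers is a magic square if the sums of the elements in each row, in each column and in each of the two main diagonals (entries $(i,i)$, and entries $(i,m+1-i)$) are all equal to the same number. For a matrix $M$, $M^{*d}$ denotes the matrix obtained by raising each entry to the $d$-th power. $M$ is an $n$-multimagic square if $M^{*d}$ is a magic square for every $d=1,2,\dots,n$. An $m\times m$ matrix is normal if its entries are the integers $1,2,\dots,m^2$, each occurring exactly once. *)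

(* Defs.v *)
From mathcomp Require Import all_boot all_order all_algebra.

Set Implicit Arguments.
Unset Strict Implicit.
Unset Printing Implicit Defensive.

Import GRing.Theory.

(* The library's GRing.unit and unitmx require a unitRingType, hence 1 != 0.
   is_unit and in_GL also make sense over the zero ring (the case q = 1). *)
Definition is_unit (R : comPzRingType) (x : R) : Prop :=
  exists y : R, (x * y = 1)%R.

Definition in_GL (R : comPzRingType) (m : nat) (X : 'M[R]_m) : Prop :=
  exists Y : 'M[R]_m, (X *m Y = 1%:M)%R /\ (Y *m X = 1%:M)%R.

(* The n x n minors of an m x n matrix: a choice of n rows is an increasing
   map f : 'I_n -> 'I_m. *)
Definition unit_minors (R : comPzRingType) (m n : nat) (A : 'M[R]_(m, n)) :
    Prop :=
  forall f : 'I_n -> 'I_m, {homo f : i j / i < j} ->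
    is_unit (\det (rowsub f A)).

Definition multimagic_generator (R : comPzRingType) (n : nat)
    (X : 'M[R]_(n + n)) : Prop :=
  [/\ in_GL X,
      unit_minors (lsubmx X),
      unit_minors (rsubmx X),
      unit_minors (lsubmx X + rsubmx X)%R
    & unit_minors (lsubmx X - rsubmx X)%R].

Definition of_type (R : zmodType) (q : nat) (N : R -> 'I_q) (c : R) : Prop :=
  forall a : R, N a + N (- a + c)%R = q - 1.

(* Coordinates are indexed from 0, so the weight of coordinate j is q ^ j rather than q ^ (j - 1). *)
Definition numbering (R : Type) (q n : nat) (N : 'I_n -> R -> 'I_q)
    (a : 'cV[R]_n) : nat :=
  1 + \sum_(j < n) q ^ j * N j (a j ord0).

(* Matrix indices start at 0 and numberings at 1, whence i.+1 and j.+1.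
   Such an M exists and is unique: see numbered_square_unique below. *)
Definition numbered_square (R : comPzRingType) (q n : nat)
    (N : 'I_n -> R -> 'I_q) (N' : 'I_(n + n) -> R -> 'I_q)
    (X : 'M[R]_(n + n)) (t : 'cV[R]_(n + n)) (M : 'M[nat]_(q ^ n)) : Prop :=
  forall (a b : 'cV[R]_n) (i j : 'I_(q ^ n)),
    i.+1 = numbering N a -> j.+1 = numbering N b ->
    M i j = numbering N' (X *m col_mx a b + t)%R.

Definition magic_square (m : nat) (M : 'M[nat]_m) : Prop :=
  exists s : nat,
    [/\ forall i, \sum_(j < m) M i j = s,
        forall j, \sum_(i < m) M i j = s,
        \sum_(i < m) M i i = s
      & \sum_(i < m) M i (rev_ord i) = s].

Definition multimagic_square (n m : nat) (M : 'M[nat]_m) : Prop :=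
  forall d, 1 <= d <= n -> magic_square (map_mx (fun x => x ^ d) M).

Definition normal_square (m : nat) (M : 'M[nat]_m) : Prop :=
  perm_eq [seq M i j | i <- enum 'I_m, j <- enum 'I_m] (iota 1 (m ^ 2)).

Lemma radix_lt (q n : nat) (f : 'I_n -> 'I_q) :
  \sum_(j < n) q ^ j * f j < q ^ n.
Proof.
elim: n f => [|n IHn] f; first by rewrite big_ord0.
rewrite big_ord_recr /= expnSr.
have lt_low := IHn (fun j => f (widen_ord (leqnSn n) j)).
apply: (@leq_trans (q ^ n + q ^ n * f ord_max)); first by rewrite ltn_add2r.
by rewrite -mulnS leq_mul2l ltn_ord orbT.
Qed.

Lemma radix_inj (q n : nat) (f g : 'I_n -> 'I_q) :
  \sum_(j < n) q ^ j * f j = \sum_(j < n) q ^ j * g j -> f =1 g.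
Proof.
elim: n f g => [|n IHn] f g; first by move=> _ [].
rewrite !big_ord_recr /= => eq_fg.
have lt_f := radix_lt (fun j => f (widen_ord (leqnSn n) j)).
have lt_g := radix_lt (fun j => g (widen_ord (leqnSn n) j)).
have qn_gt0 : 0 < q ^ n by apply: leq_ltn_trans lt_f.
have eq_low : \sum_(j < n) q ^ j * f (widen_ord (leqnSn n) j) =
              \sum_(j < n) q ^ j * g (widen_ord (leqnSn n) j).
  move/(congr1 (modn^~ (q ^ n))): (eq_fg).
  by rewrite /= ![_ + q ^ n * _]addnC ![q ^ n * _]mulnC !modnMDl !modn_small.
move=> j; case: (unliftP ord_max j) => [k|] ->.
  have -> : lift ord_max k = widen_ord (leqnSn n) k.
    by apply: val_inj; exact: lift_max.
  exact: (IHn (fun k => f (widen_ord (leqnSn n) k))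
              (fun k => g (widen_ord (leqnSn n) k))).
apply/val_inj/eqP; move/eqP: eq_fg.
by rewrite eq_low eqn_add2l eqn_pmul2l.
Qed.

Lemma numbering_bounds (R : Type) (q n : nat) (N : 'I_n -> R -> 'I_q)
    (a : 'cV[R]_n) :
  1 <= numbering N a <= q ^ n.
Proof. exact: (radix_lt (fun j => N j (a j ord0))). Qed.

Lemma numbering_inj (R : Type) (q n : nat) (N : 'I_n -> R -> 'I_q) :
  (forall j, bijective (N j)) -> injective (@numbering R q n N).
Proof.
move=> bijN a b /addnI /(@radix_inj q n (fun j => N j (a j ord0))
                                        (fun j => N j (b j ord0))) eqN.
apply/matrixP => i k; rewrite ord1.
exact: (bij_inj (bijN i)) (eqN i).
Qed.

Lemma numbering_surj (R : finType) (q n : nat) (N : 'I_n -> R -> 'I_q) :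
  #|R| = q -> (forall j, bijective (N j)) ->
  forall k, 1 <= k <= q ^ n -> exists a, numbering N a = k.
Proof.
move=> cardR bijN [//|k] /= ltk.
pose F (a : 'cV[R]_n) : 'I_(q ^ n) := Ordinal (radix_lt (fun j => N j (a j ord0))).
have injF : injective F.
  move=> a b [eqF]; apply: (numbering_inj bijN); congr (1 + _); exact: eqF.
have [G _ FG] : bijective F.
  by apply: inj_card_bij injF _; rewrite card_mx card_ord cardR muln1.
exists (G (Ordinal ltk)).
by rewrite /numbering -[k.+1]/(1 + Ordinal ltk) -{2}(FG (Ordinal ltk)).
Qed.

Lemma numbered_square_unique (R : finComPzRingType) (q n : nat)
    (N : 'I_n -> R -> 'I_q) (N' : 'I_(n + n) -> R -> 'I_q)
    (X : 'M[R]_(n + n)) (t : 'cV[R]_(n + n)) :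
  #|R| = q -> (forall j, bijective (N j)) ->
  exists! M : 'M[nat]_(q ^ n), numbered_square N N' X t M.
Proof.
move=> cardR bijN.
have surjN (i : 'I_(q ^ n)) : exists a, numbering N a == i.+1.
  have [a Na] := numbering_surj cardR bijN (k := i.+1) (ltn_ord i).
  by exists a; rewrite Na.
pose G i := xchoose (surjN i).
have numG i : numbering N (G i) = i.+1 by apply/eqP/(xchooseP (surjN i)).
exists (\matrix_(i, j) numbering N' (X *m col_mx (G i) (G j) + t))%R.
split=> [a b i j eq_i eq_j | M defM].
  rewrite mxE; congr (numbering N' (X *m col_mx _ _ + t)%R);
    by apply: (numbering_inj bijN); rewrite numG.
apply/matrixP => i j; rewrite mxE; apply/esym/defM; exact/esym/numG.
Qed.

(* Main.v *)
Require Import Defs.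
From mathcomp Require Import all_boot all_order all_algebra.

(** Write X = (A B). Along a row, a column or a diagonal of M, the vector fed
    to the numbering N' is C b + u, where b runs over R^n, u is fixed and C is
    respectively B, A, A + B or A - B; on the antidiagonal this is because the
    types of the N_j turn the reflection of the index into a |-> c - a. A d-th
    power with d <= n expands into monomials that involve at most n of the 2n
    coordinates of C b + u, and any n of these coordinates run bijectively over
    R^n, since the n x n minors of C are units. So the power sum depends neither
    on C nor on u. *)

Import Order.TTheory GRing.Theory.

Lemma exists_superset_card (T : finType) (A : {set T}) (n : nat) :
  #|A| <= n <= #|T| -> exists2 S : {set T}, A \subset S & #|S| = n.
Proof.
case/andP=> leAn lenT.
have [k def_n] : exists k, n = #|A| + k by exists (n - #|A|); rewrite subnKC.
elim: k A n {leAn} def_n lenT => [|k IHk] A n ->.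
  by move=> _; exists A; rewrite ?addn0.
rewrite addnS => ltAT; have [x Ax] : exists x, x \in ~: A.
  by apply/card_gt0P; rewrite cardsCs setCK subn_gt0 (leq_ltn_trans _ ltAT)
                         ?leq_addr.
have [|S sAS cardS] := IHk (x |: A) _ _ ltAT.
  by rewrite cardsU1 -in_setC Ax.
by exists S => //; apply: subset_trans sAS; apply: subsetUr.
Qed.

(** The factors of a monomial may repeat coordinates in any order, while minors need increasing
    rows: the image of [f] is padded to [n] elements and enumerated in increasing order. *)
Lemma increasing_cover (d n m : nat) (f : 'I_d -> 'I_m) :
  d <= n <= m ->
  exists g : 'I_n -> 'I_m,
    {homo g : i j / i < j} /\ forall k, exists i, g i = f k.
Proof.
case/andP=> le_dn le_nm.
have [|S /subsetP sfS cardS] := @exists_superset_card _ [set f k | k in 'I_d] n.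
  by rewrite card_ord le_nm (leq_trans (leq_imset_card _ _)) ?card_ord.
exists (fun i => Order.enum_val (cast_ord (esym cardS) i)); split.
  move=> i j lt_ij.
  have monoS := @Order.EnumVal.le_enum_val _ _ (@le_total _ 'I_m) [in S].
  by have := leW_mono monoS (cast_ord (esym cardS) i) (cast_ord (esym cardS) j);
     rewrite !ltEord /= lt_ij => ->.
move=> k; have Sfk : f k \in S by apply/sfS/imset_f.
exists (cast_ord cardS (Order.enum_rank_in Sfk (f k))).
by rewrite cast_ordK Order.enum_rankK_in.
Qed.

(** An inverse of the determinant times the adjugate is a left inverse of [C], and an injective
    self-map of a finite set is bijective. *)
Lemma unit_det_affine_bij (R : finComPzRingType) (n : nat) (C : 'M[R]_n)
    (u : 'cV[R]_n) :
  is_unit (\det C) -> bijective (fun b : 'cV[R]_n => C *m b + u)%R.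
Proof.
case=> y Cy; apply: injF_bij => b b' /addIr /(congr1 (mulmx (\adj C))).
rewrite !mulmxA mul_adj_mx !mul_scalar_mx => /(congr1 (GRing.scale y)).
by rewrite !scalerA mulrC Cy !scale1r.
Qed.

Lemma eq_power_sum (R : finComPzRingType) (m n d : nat) (C C' : 'M[R]_(m, n))
    (W : 'I_m -> R -> nat) (u u' : 'cV[R]_m) :
  n <= m -> d <= n -> unit_minors C -> unit_minors C' ->
  \sum_(b : 'cV[R]_n) (\sum_j W j ((C *m b + u)%R j ord0)) ^ d =
  \sum_(b : 'cV[R]_n) (\sum_j W j ((C' *m b + u')%R j ord0)) ^ d.
Proof.
move=> le_nm le_dn unitC unitC'.
have expand (x : 'I_m -> nat) :
    (\sum_j x j) ^ d = \sum_(f : {ffun 'I_d -> 'I_m}) \prod_k x (f k).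
  by rewrite -(bigA_distr_bigA (fun=> x)) prod_nat_const card_ord.
under eq_bigr do rewrite expand; under [RHS]eq_bigr do rewrite expand.
rewrite exchange_big [RHS]exchange_big; apply: eq_bigr => f _ /=.
have [|g [g_incr g_cover]] := @increasing_cover d n m f; first by rewrite le_dn.
have [h gh] := fin_all_exists g_cover.
(* Since [g (h k) = f k], the monomial is [Phi] at the rows of [D *m b + v] selected by [g], and
   these rows depend bijectively on [b]. *)
pose Phi (v : 'cV[R]_n) := \prod_k W (f k) (v (h k) ord0).
suff sumPhi (D : 'M[R]_(m, n)) (v : 'cV[R]_m) : unit_minors D ->
    \sum_(b : 'cV[R]_n) \prod_k W (f k) ((D *m b + v)%R (f k) ord0) =
    \sum_b Phi b by rewrite !sumPhi.
move=> unitD; have bijD := unit_det_affine_bij _ _ _ (rowsub g v) (unitD g g_incr).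
rewrite [RHS](reindex _ (onW_bij _ bijD)); apply: eq_bigr => b _.
apply: eq_bigr => k _; congr (W _ _).
by rewrite mul_rowsub_mx !mxE gh.
Qed.

(** The leading 1 of a numbering is split off by the binomial theorem, which leaves powers [k <= d]
    of the weighted digit sum. *)
Lemma eq_numbering_power_sum (R : finComPzRingType) (q m n d : nat)
    (C C' : 'M[R]_(m, n)) (N : 'I_m -> R -> 'I_q) (u u' : 'cV[R]_m) :
  n <= m -> d <= n -> unit_minors C -> unit_minors C' ->
  \sum_(b : 'cV[R]_n) numbering N (C *m b + u)%R ^ d =
  \sum_(b : 'cV[R]_n) numbering N (C' *m b + u')%R ^ d.
Proof.
move=> le_nm le_dn unitC unitC'; rewrite /numbering.
under eq_bigr do rewrite expnDn; under [RHS]eq_bigr do rewrite expnDn.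
rewrite exchange_big [RHS]exchange_big; apply: eq_bigr => k _ /=.
under eq_bigr do rewrite exp1n mul1n; under [RHS]eq_bigr do rewrite exp1n mul1n.
rewrite -big_distrr -[RHS]big_distrr /=; congr (_ * _).
apply: (eq_power_sum _ _ _ _ _ _ (fun j x => q ^ j * N j x)) => //.
by rewrite (leq_trans _ le_dn) // -ltnS.
Qed.

(** Digits in the same place add up to [q - 1], so the weighted sums telescope to [q ^ n - 1]; the
    two leading 1s supply the rest. *)
Lemma numbering_opp (R : zmodType) (q n : nat) (N : 'I_n -> R -> 'I_q)
    (c : 'I_n -> R) (a : 'cV[R]_n) :
  0 < q -> (forall j, of_type (N j) (c j)) ->
  numbering N a + numbering N (- a + \col_j c j)%R = (q ^ n).+1.
Proof.
move=> q_gt0 N_type; rewrite /numbering addnACA -big_split /=.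
under eq_bigr do rewrite !mxE -mulnDr N_type.
rewrite addSn; congr S.
elim: (n) => [|k IHk]; first by rewrite big_ord0 expn0.
rewrite big_ord_recr /= -addSn IHk -[X in X + _]muln1 -mulnDr subnKC //.
by rewrite expnSr.
Qed.

Lemma numbering_ord (R : finType) (q n : nat) (N : 'I_n -> R -> 'I_q) :
  #|R| = q -> (forall j, bijective (N j)) ->
  exists2 F : 'cV[R]_n -> 'I_(q ^ n),
    bijective F & forall a, (F a).+1 = numbering N a.
Proof.
move=> cardR bijN.
exists (fun a => Ordinal (radix_lt (fun j => N j (a j ord0)))) => //.
apply: inj_card_bij; last by rewrite card_mx card_ord cardR muln1.
by move=> a b [eqF]; apply: (numbering_inj bijN); congr (1 + _).
Qed.

Theorem theorem2p2 (n q : nat) (R : finComPzRingType)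
    (hn : 1 <= n) (hq : #|R| = q)
    (N : 'I_n -> R -> 'I_q) (c : 'I_n -> R)
    (N_bij : forall j : 'I_n, bijective (N j))
    (N_type : forall j : 'I_n, of_type (N j) (c j))
    (N' : 'I_(n + n) -> R -> 'I_q) (c' : 'I_(n + n) -> R)
    (N'_bij : forall j : 'I_(n + n), bijective (N' j))
    (N'_type : forall j : 'I_(n + n), of_type (N' j) (c' j))
    (X : 'M[R]_(n + n)) (hX : multimagic_generator X)
    (t : 'cV[R]_(n + n))
    (M : 'M[nat]_(q ^ n)) (hM : numbered_square N N' X t M) :
  normal_square M /\ multimagic_square n M.
Proof.
have [F bijF defF] := numbering_ord _ _ _ _ hq N_bij.
have MF a b : M (F a) (F b) = numbering N' (X *m col_mx a b + t)%R by apply: hM.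
have [FV FK FVK] := bijF.
have q_gt0 : 0 < q by rewrite -hq; apply/card_gt0P; exists 0%R.
case: hX => [[Y [_ YX]] unitA unitB unitAB unitA_B].
split.
  rewrite /normal_square.
  have size_s : size [seq M i j | i <- enum 'I_(q ^ n), j <- enum 'I_(q ^ n)]
      = (q ^ n) ^ 2 by rewrite size_allpairs size_enum_ord mulnn.
  have uniq_s : uniq [seq M i j | i <- enum 'I_(q ^ n), j <- enum 'I_(q ^ n)].
    apply: allpairs_uniq; rewrite ?enum_uniq // => -[i j] [i' j'] _ _ /=.
    (* Equal entries come from equal vectors, as [N'] numbers injectively and [Y] cancels [X]. *)
    rewrite -(FVK i) -(FVK j) -(FVK i') -(FVK j') !MF.
    move=> /(numbering_inj N'_bij) /addIr /(congr1 (mulmx Y)).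
    by rewrite !mulmxA YX !mul1mx => /eq_col_mx [-> ->].
  apply: uniq_perm => //; first exact: iota_uniq.
  (* Distinct entries, all in the range and as many as the range has elements, fill it. *)
  have [||_ //] := uniq_min_size (s2 := iota 1 ((q ^ n) ^ 2)) uniq_s.
    move=> x /allpairsP[[i j] [_ _ ->]] /=.
    rewrite -(FVK i) -(FVK j) MF mem_iota add1n ltnS -expnM muln2 -addnn.
    exact: numbering_bounds.
  by rewrite size_iota size_s.
move=> d /andP[_ le_dn].
(* Any block with unit minors and any shift would define the same [s]. *)
pose s := \sum_(b : 'cV[R]_n) numbering N' (rsubmx X *m b + 0)%R ^ d.
have sumE (C : 'M[R]_(n + n, n)) (u : 'cV[R]_(n + n)) : unit_minors C ->
    \sum_b numbering N' (C *m b + u)%R ^ d = s.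
  by move=> unitC; apply: eq_numbering_power_sum; rewrite ?leq_addr.
have split_X (a b : 'cV[R]_n) :
    (X *m col_mx a b = lsubmx X *m a + rsubmx X *m b)%R.
  by rewrite -{1}(hsubmxK X) mul_row_col.
exists s; split=> [i|j||].
- rewrite (reindex F (onW_bij _ bijF)) -(sumE _ (lsubmx X *m FV i + t)%R unitB).
  apply: eq_bigr => b _; rewrite mxE -{1}(FVK i) MF split_X.
  by rewrite addrCA addrA.
- rewrite (reindex F (onW_bij _ bijF)) -(sumE _ (rsubmx X *m FV j + t)%R unitA).
  by apply: eq_bigr => a _; rewrite mxE -{1}(FVK j) MF split_X addrA.
- rewrite (reindex F (onW_bij _ bijF)) -(sumE _ t unitAB).
  by apply: eq_bigr => a _; rewrite mxE MF split_X mulmxDl.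
(* Reversed indices, counted from 0, add up to [q ^ n - 1], hence their numberings to [q ^ n + 1],
   as in [numbering_opp]. *)
have revF a : rev_ord (F a) = F (- a + \col_j c j)%R.
  apply/val_inj/eqP; rewrite /= defF.
  rewrite -(eqn_add2l (numbering N a)) subnKC; last first.
    by have /andP[] := numbering_bounds N a.
  by rewrite -eqSS -addnS defF numbering_opp.
rewrite (reindex F (onW_bij _ bijF)).
(* With X = (A B), A a + B (c - a) = (A - B) a + B c. *)
rewrite -(sumE _ (rsubmx X *m (\col_j c j) + t)%R unitA_B).
apply: eq_bigr => a _; rewrite mxE revF MF split_X.
by rewrite mulmxDr mulmxN mulmxBl !addrA.
Qed.
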